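(* Let $p,q,m\ge 0$ be integers with $q+m\ge 1$ and $p+m\ge 1$, and let $i\ge 0$ be an integer. Let $R$ be the regular representation over $\mathbb C$ of the cyclic group $C_{q+m}$ of order $q+m$, and let $\tilde R$ be the regular representation over $\mathbb C$ of the cyclic group $C_{p+m}$ of order $p+m$. Then $$\dim\bigl((S^pR\otimes\wedge^mR)_{C_{q+m},\chi_i}\bigr)=\dim\bigl((S^q\tilde R\otimes\wedge^m\tilde R)_{C_{p+m},\chi_i}\bigr).$$
   Context: $S^p$ and $\wedge^m$ denote symmetric and exterior powers. For each $n\ge1$, fix a generator $\gamma$ of the cyclic group $C_n$ of order $n$ and a primitive $n$-th root of unity $\zeta$; $\chi_i:C_n\to\mathbb C^\times$ is the linear character with $\chi_i(\gamma)=\zeta^i$ (so on each of the two groups $\chi_i$ is understood with respect to that group). For a $C_n$-module $W$, $W_{C_n,\chi_i}=\{w\in W: g\cdot w=\chi_i(g)w\text{ for all }g\in C_n\}$ is the isotypic component of type $\chi_i$. *)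

(* Defs.v *)
From HB Require Import structures.
From mathcomp Require Import all_boot all_order all_algebra all_fingroup.
From mathcomp Require Import all_solvable all_field all_character.
From mathcomp Require Import boolp reals complex.

Set Implicit Arguments.
Unset Strict Implicit.
Unset Printing Implicit Defensive.

Import GroupScope GRing.Theory.
Local Open Scope ring_scope.

(* Vectors are rows and representations act on the right, as in
   mxrepresentation; a subspace of 'rV_n is the row space of a matrix. *)

Section Span.

Variables (F : fieldType) (n : nat).

Definition is_mxspan (P : 'rV[F]_n -> Prop) (U : 'M[F]_n) : Prop :=
  (forall w, P w -> (w <= U)%MS) /\
  (forall V : 'M[F]_n, (forall w, P w -> (w <= V)%MS) -> (U <= V)%MS).

Lemma mxspan_exists (P : 'rV[F]_n -> Prop) : exists U, is_mxspan P U.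
Proof.
pose ok r := `[< exists U : 'M[F]_n,
                   (forall w, P w -> (w <= U)%MS) /\ \rank U = r >].
have okn : exists r, ok r.
  by exists (\rank (1%:M : 'M[F]_n)); apply/asboolP; exists 1%:M; split=> // w _;
     rewrite submx1.
case: (ex_minnP okn) => r /asboolP[U [PU rU]] minr; exists U; split=> // V PV.
have PUV w : P w -> (w <= U :&: V)%MS by move=> Pw; rewrite sub_capmx PU ?PV.
have : (r <= \rank (U :&: V)%MS)%N.
  by apply: minr; apply/asboolP; exists (U :&: V)%MS.
rewrite -rU (geq_leqif (mxrank_leqif_sup (capmxSl U V))) => sUUV.
exact: submx_trans sUUV (capmxSr U V).
Qed.

(* The linear span of a possibly infinite set of vectors. *)
Definition mxspan (P : 'rV[F]_n -> Prop) : 'M[F]_n :=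
  sval (cid (mxspan_exists P)).

Lemma mxspanP (P : 'rV[F]_n -> Prop) : is_mxspan P (mxspan P).
Proof. exact: svalP (cid (mxspan_exists P)). Qed.

Lemma mxspan_stable (P : 'rV[F]_n -> Prop) (A : 'M[F]_n) :
  (forall w, P w -> P (w *m A)) -> (mxspan P *m A <= mxspan P)%MS.
Proof.
have [PU minU] := mxspanP P => PA.
pose K := kermx (A *m cokermx (mxspan P)).
have sK w : (w <= K)%MS = (w *m A <= mxspan P)%MS.
  by rewrite [RHS]submxE -mulmxA; apply/sub_kermxP/eqP.
suff : (mxspan P <= K)%MS by move/sub_kermxP; rewrite mulmxA submxE => ->.
by apply: minU => w Pw; rewrite sK; apply/PU/PA.
Qed.

End Span.

Section TensorPower.

Variables (F : fieldType) (k n : nat).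

(* The standard basis of the k-th tensor power of 'rV_n is indexed by the
   functions 'I_k -> 'I_n, the function f standing for
   e_(f 0) (x) ... (x) e_(f (k - 1)). *)
Definition tpow_dim := #|{ffun 'I_k -> 'I_n}|.

Definition tpow_index (e : 'I_tpow_dim) : {ffun 'I_k -> 'I_n} := enum_val e.

Definition pure_tensor (v : 'I_k -> 'rV[F]_n) : 'rV[F]_tpow_dim :=
  \row_e \prod_j v j 0 (tpow_index e j).

Definition tpow_mx (A : 'M[F]_n) : 'M[F]_tpow_dim :=
  \matrix_e pure_tensor (fun j => row (tpow_index e j) A).

Lemma pure_tensor_mx v A :
  pure_tensor v *m tpow_mx A = pure_tensor (fun j => v j *m A).
Proof.
apply/rowP=> f; rewrite !mxE; under [RHS]eq_bigr do rewrite mxE.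
rewrite (bigA_distr_bigA (fun j a => v j 0 a * A a (tpow_index f j))) /=.
rewrite [RHS](reindex tpow_index) /=; last first.
  by apply/onW_bij/enum_val_bij.
apply: eq_bigr => e _; rewrite !mxE -big_split /=.
by apply: eq_bigr => j _; rewrite mxE.
Qed.

Lemma tpow_mx1 : tpow_mx 1%:M = 1%:M.
Proof.
apply/matrixP=> e f; rewrite !mxE.
case: (eqVneq e f) => [->|nef].
  by rewrite big1 // => j _; rewrite !mxE eqxx.
have /existsP[j nj] : [exists j, tpow_index e j != tpow_index f j].
  rewrite -negb_forall; apply: contra nef => /forallP h.
  by apply/eqP/enum_val_inj/ffunP => j; apply/eqP.
by rewrite (bigD1 j) //= !mxE (negPf nj) mul0r.
Qed.

Lemma tpow_mxM A B : tpow_mx (A *m B) = tpow_mx A *m tpow_mx B.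
Proof.
apply/row_matrixP=> e; rewrite row_mul !rowK pure_tensor_mx.
by apply/rowP=> f; rewrite !mxE; apply: eq_bigr => j _; rewrite row_mul.
Qed.

Definition sym_relation (w : 'rV[F]_tpow_dim) : Prop :=
  exists (v : 'I_k -> 'rV[F]_n) (s : 'S_k),
    w = pure_tensor v - pure_tensor (fun j => v (s j)).

Definition alt_relation (w : 'rV[F]_tpow_dim) : Prop :=
  exists v : 'I_k -> 'rV[F]_n,
    (exists i j, i != j /\ v i = v j) /\ w = pure_tensor v.

End TensorPower.

Section Powers.

Variables (F : fieldType) (gT : finGroupType) (G : {group gT}).
Variables (k n : nat) (rG : mx_representation F G n).

Lemma tpow_mx_repr : mx_repr G (fun g => tpow_mx k (rG g)).
Proof.
by split=> [|x y Gx Gy]; rewrite ?repr_mx1 ?tpow_mx1 // repr_mxM // tpow_mxM.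
Qed.

Definition tpow_repr := MxRepresentation tpow_mx_repr.

Lemma sym_relation_module : mxmodule tpow_repr (mxspan (@sym_relation F k n)).
Proof.
apply/mxmoduleP=> g _; apply: mxspan_stable => _ [v [s ->]].
by exists (fun j => v j *m rG g), s; rewrite mulmxBl !pure_tensor_mx.
Qed.

Lemma alt_relation_module : mxmodule tpow_repr (mxspan (@alt_relation F k n)).
Proof.
apply/mxmoduleP=> g _; apply: mxspan_stable => _ [v [[i [j [nij vij]]] ->]].
exists (fun j => v j *m rG g); rewrite pure_tensor_mx; split=> //.
by exists i, j; rewrite vij.
Qed.

Definition sym_repr := factmod_repr sym_relation_module.

Definition ext_repr := factmod_repr alt_relation_module.

End Powers.

Definition isotypic_mx (F : fieldType) (gT : finGroupType) (G : {group gT})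
    (n : nat) (rG : mx_representation F G n) (chi : gT -> F) : 'M[F]_n :=
  (\bigcap_(g in G) eigenspace (rG g) (chi g))%MS.

Lemma isotypic_mxP (F : fieldType) (gT : finGroupType) (G : {group gT})
    (n : nat) (rG : mx_representation F G n) (chi : gT -> F) (w : 'rV[F]_n) :
  reflect (forall g, g \in G -> w *m rG g = chi g *: w)
          (w <= isotypic_mx rG chi)%MS.
Proof.
apply: (iffP sub_bigcapmxP) => h g /h; first by move/eigenspaceP.
by move=> e; apply/eigenspaceP.
Qed.

(* The character a ^+ k |-> z ^+ (i * k) of <[a]>; the index below is the
   discrete logarithm of g. *)
Definition cycle_char (F : fieldType) (gT : finGroupType) (a : gT) (z : F)
    (i : nat) (g : gT) : F :=
  z ^+ (i * index g [seq (a ^+ k)%g | k <- iota 0 #[a]%g]).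

Lemma cycle_charX (F : fieldType) (gT : finGroupType) (a : gT) (z : F)
    (i k : nat) :
  #[a]%g.-primitive_root z -> cycle_char a z i (a ^+ k)%g = z ^+ (i * k).
Proof.
move=> prim_z; rewrite /cycle_char; set s := map _ _.
have lt_k : (k %% #[a]%g < #[a]%g)%N by rewrite ltn_mod order_gt0.
have uniq_s : uniq s.
  rewrite map_inj_in_uniq ?iota_uniq // => x y.
  rewrite !mem_iota !add0n /= => ltx lty /eqP.
  by rewrite eq_expg_mod_order !modn_small // => /eqP.
have -> : index (a ^+ k)%g s = (k %% #[a]%g)%N.
  rewrite -expg_mod_order.
  have -> : (a ^+ (k %% #[a]%g))%g = nth 1%g s (k %% #[a]%g).
    by rewrite (nth_map 0%N) ?size_iota // nth_iota.
  by rewrite index_uniq // size_map size_iota.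
apply/eqP; rewrite (eq_prim_root_expr prim_z).
by rewrite modnMmr.
Qed.

(* Main.v *)
(** With n = q + m, the regular representation has an eigenbasis with weights
    0, ..., n - 1, so the character of S^p R (x) /\^m R at gamma^k is F(zeta^k)
    for F = h_p(1, x, ..., x^(n-1)) e_m(1, x, ..., x^(n-1)), and the dimension
    sought is the sum of the coefficients of F with index congruent to i mod n.
    In terms of q-integers
      F = [n] x^C(m,2) [p+q+m-1]! / ([p]! [q]! [m]!),
    where everything but [n] is symmetric in p and q.  If F' is the polynomial
    of the other side, then [p + m] F = [q + m] F'.  For g = gcd(p + m, q + m),
    a Bezout relation for [q + m] and [p + m] yields a polynomial H with
    F = ([q + m]/[g]) H and F' = ([p + m]/[g]) H; since [n]/[g] is the sum of
    the x^(gk), k < n/g, both residue sums equal the one of H modulo g. *)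
Require Import Defs.
From mathcomp Require Import all_boot all_order all_algebra all_fingroup.
From mathcomp Require Import all_solvable all_field all_character.
From mathcomp Require Import boolp reals complex.
From mathcomp Require Import ring zify.

Set Implicit Arguments.
Unset Strict Implicit.
Unset Printing Implicit Defensive.

Import GroupScope GRing.Theory.
Local Open Scope ring_scope.

(** * q-binomial coefficients and residue sums *)

(* The nonincreasing (for [strict = false]) or decreasing (for [strict = true])
   words of length k with letters < d; they index the standard bases of the
   k-th symmetric and exterior powers of a space of dimension d. *)
Fixpoint words (strict : bool) (d k : nat) {struct k} : seq (seq nat) :=
  if k is k'.+1 then
    (fix words_below d := if d is d'.+1 then
       words_below d' ++
       [seq d' :: s | s <- words strict (if strict then d' else d) k']
     else [::]) d
  else [:: [::]].

Lemma wordsSS strict d k :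
  words strict d.+1 k.+1 = words strict d k.+1 ++
    [seq d :: s | s <- words strict (if strict then d else d.+1) k].
Proof. by []. Qed.

Definition word_rel (strict : bool) : rel nat :=
  fun x y => if strict then (y < x)%N else (y <= x)%N.

Lemma word_rel_trans strict : transitive (word_rel strict).
Proof. by case: strict => y x z /=; lia. Qed.

Lemma mem_words strict d k s :
  (s \in words strict d k) =
  [&& size s == k, all (fun x => x < d)%N s & sorted (word_rel strict) s].
Proof.
elim: k d s => [|k IHk] d s; first by rewrite inE; case: s.
elim: d s => [|d IHd] s.
  by case: s => [|x s] //=; rewrite in_nil andbF.
rewrite wordsSS mem_cat IHd.
set d' := if strict then d else d.+1.
have memP : (s \in [seq d :: t | t <- words strict d' k]) =
    if s is x :: t then (x == d) && (t \in words strict d' k) else false.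
  case: s => [|x t]; first by apply/negP => /mapP[].
  apply/mapP/andP => [[u mu [-> ->]] | [/eqP-> mt]]; first by rewrite eqxx.
  by exists t.
rewrite {}memP; case: s => [|x s] //=; rewrite IHk eqSS.
have [/= _|_] := eqVneq (size s) k; last by rewrite andbF.
rewrite !(path_sortedE (@word_rel_trans strict)).
have sub (P Q : pred nat) : (forall y, P y = Q y) -> all P s = all Q s.
  by move=> e; apply: eq_all.
have [-> | nx] := eqVneq x d.
  rewrite ltnn ltnSn /= /d'; case: (sorted _ s); rewrite ?andbF // !andbT.
  rewrite -all_predI; apply: sub => y /=; rewrite /word_rel.
  by case: (strict) => //=; lia.
rewrite /= orbF.
have -> : (x < d.+1)%N = (x < d)%N by lia.
have [ltxd /=|//] := ltnP x d.
rewrite !andbA -!all_predI; congr (_ && _); apply: sub => y /=; rewrite /word_rel.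
by case: (strict) => //=; lia.
Qed.

Lemma words_uniq strict d k : uniq (words strict d k).
Proof.
elim: k d => [|k IHk] d //; elim: d => [|d IHd] //.
rewrite wordsSS cat_uniq IHd map_inj_uniq ?IHk => [|s t []//].
rewrite andbT; apply/hasPn => _ /mapP[s _ ->].
by rewrite [_ \in _]mem_words [all _ _]/= ltnn andbF.
Qed.

Section QAnalogues.

Variable K : fieldType.
Implicit Types (P Q : {poly K}) (d k n : nat).

(** The principal specialization at [1, 'X, ..., 'X^(d-1)] of the complete symmetric polynomial h_k
    (weak words) or of the elementary one e_k (strict words). *)
Definition word_poly strict d k : {poly K} :=
  \sum_(s <- words strict d k) 'X^(sumn s).

(** A q-Pascal recurrence: the second term collects the words whose first, hence largest, letter is
    [d]. *)
Lemma word_polySS strict d k :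
  word_poly strict d.+1 k.+1 = word_poly strict d k.+1 +
    'X^d * word_poly strict (if strict then d else d.+1) k.
Proof.
rewrite /word_poly wordsSS big_cat big_map big_distrr /=; congr (_ + _).
by apply: eq_bigr => s _; rewrite exprD.
Qed.

Lemma word_poly0 strict d : word_poly strict d 0 = 1.
Proof. by rewrite /word_poly /= big_seq1 expr0. Qed.

Lemma strict_word_poly_eq0 d k : (d < k)%N -> word_poly true d k = 0.
Proof.
elim: d k => [|d IHd] [|k] // ltdk; first by rewrite /word_poly big_nil.
by rewrite word_polySS !IHd ?mulr0 ?addr0 // ltnW.
Qed.

(* The q-integer [n] in the variable 'X. *)
Definition qint n : {poly K} := \sum_(j < n) 'X^j.

Definition qfact n : {poly K} := \prod_(j < n) qint j.+1.

Lemma qintE n : ('X - 1) * qint n = 'X^n - 1.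
Proof. by rewrite subrX1. Qed.

Lemma qintD m n : qint (m + n) = qint m + 'X^m * qint n.
Proof.
rewrite /qint big_split_ord big_distrr /=; congr (_ + _).
by apply: eq_bigr => j _; rewrite exprD.
Qed.

Lemma qintM m n : qint (m * n) = qint m * \sum_(j < n) 'X^(m * j).
Proof.
elim: n => [|n IHn]; first by rewrite muln0 /qint !big_ord0 mulr0.
by rewrite mulnSr qintD IHn big_ord_recr /= mulrDr (mulrC (qint m) 'X^_).
Qed.

Lemma qint_neq0 n : (0 < n)%N -> qint n != 0.
Proof.
move=> n_gt0; apply/eqP => q0; have := qintE n; rewrite q0 mulr0 => /esym/eqP.
by rewrite -[1]/(1%:P) -size_poly_eq0 size_XnsubC.
Qed.

Lemma qfactS n : qfact n.+1 = qfact n * qint n.+1.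
Proof. by rewrite /qfact big_ord_recr. Qed.

Lemma qfact_neq0 n : qfact n != 0.
Proof. by apply/prodf_neq0 => j _; apply: qint_neq0. Qed.

(** The Gaussian binomial of d+k over k, with denominators cleared to stay among polynomials. The
    two terms of [word_polySS] match the two terms of [qintD]. *)
Lemma weak_word_polyE d k :
  qfact d * qfact k * word_poly false d.+1 k = qfact (d + k).
Proof.
have qfact0 : qfact 0 = 1 by rewrite /qfact big_ord0.
elim: k d => [|k IHk] d.
  by rewrite word_poly0 addn0 qfact0 !mulr1.
elim: d => [|d IHd].
  rewrite word_polySS /= {1}/word_poly big_nil add0r expr0 mul1r add0n qfactS.
  by have := IHk 0%N; rewrite qfact0 add0n !mul1r => {2}<-; ring.
rewrite word_polySS /=.
have -> : qfact (d.+1 + k.+1) = qint (d.+1 + k.+1) * qfact (d.+1 + k).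
  by rewrite addnS qfactS mulrC.
rewrite qintD mulrDl -{2}(IHk d.+1).
have -> : (d.+1 + k = d + k.+1)%N by lia.
by rewrite -IHd !qfactS; ring.
Qed.

(** The Gaussian binomial of q+k over k, shifted by 0 + 1 + ... + (k-1), the least weight of a
    strict word. *)
Lemma strict_word_polyE q k :
  qfact q * qfact k * word_poly true (q + k) k = 'X^'C(k, 2) * qfact (q + k).
Proof.
have qfact0 : qfact 0 = 1 by rewrite /qfact big_ord0.
elim: k q => [|k IHk] q.
  by rewrite word_poly0 addn0 qfact0 expr0 !mulr1 mul1r.
have -> : 'X^('C(k.+1, 2)) = 'X^k * 'X^('C(k, 2)) :> {poly K}.
  by rewrite binS bin1 exprD mulrC.
elim: q => [|q IHq].
  have := IHk 0%N; rewrite !add0n word_polySS (@strict_word_poly_eq0 k k.+1) //= add0r.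
  rewrite qfact0 !mul1r qfactS => e.
  transitivity ('X^k * qint k.+1 * ('X^('C(k, 2)) * qfact k)); last by ring.
  by rewrite -e; ring.
have := IHk q.+1; have -> : (q.+1 + k.+1 = (q + k.+1).+1)%N by lia.
rewrite word_polySS /= (_ : q.+1 + k = q + k.+1)%N; last by lia.
move=> e; rewrite mulrDr.
have -> : qfact q.+1 * qfact k.+1 * word_poly true (q + k.+1) k.+1 =
    qint q.+1 * ('X^k * 'X^('C(k, 2)) * qfact (q + k.+1)).
  by rewrite -IHq qfactS; ring.
have -> : qfact q.+1 * qfact k.+1 *
    ('X^(q + k.+1) * word_poly true (q + k.+1) k) =
    'X^(q + k.+1) * qint k.+1 * ('X^('C(k, 2)) * qfact (q + k.+1)).
  by rewrite -e !qfactS; ring.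
rewrite qfactS (_ : (q + k.+1).+1 = q.+1 + k.+1)%N; last by lia.
by rewrite qintD (_ : q + k.+1 = q.+1 + k)%N ?exprD; [ring | lia].
Qed.

Definition pair_poly n k m : {poly K} := word_poly false n k * word_poly true n m.

Lemma pair_polyC p q m : (0 < q + m)%N -> (0 < p + m)%N ->
  qint (p + m) * pair_poly (q + m) p m = qint (q + m) * pair_poly (p + m) q m.
Proof.
move=> qm_gt0 pm_gt0.
(* Only the factor [qint (b + m)] breaks the symmetry between [a] and [b]. It arises because h_a on
   [b + m] letters involves [qfact (b + m).-1], one factor short of [qfact (b + m)]. *)
have pairE a b : (0 < b + m)%N ->
    qfact a * qfact b * qfact m * pair_poly (b + m) a m =
    qint (b + m) * ('X^('C(m, 2)) * qfact (a + b + m).-1).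
  move=> bm_gt0; have := strict_word_polyE b m; rewrite /pair_poly.
  rewrite -addnA; case: (b + m)%N bm_gt0 => // N _; rewrite addnS /= qfactS => e2.
  have e1 := weak_word_polyE N a; rewrite (addnC a N) -e1.
  transitivity (qfact a * word_poly false N.+1 a *
    (qfact b * qfact m * word_poly true N.+1 m)); first by ring.
  by rewrite e2; ring.
apply: (mulfI (qfact_neq0 p)); apply: (mulfI (qfact_neq0 q)).
apply: (mulfI (qfact_neq0 m)).
have eq1 := pairE p q qm_gt0; have eq2 := pairE q p pm_gt0.
transitivity (qint (p + m) *
  (qint (q + m) * ('X^('C(m, 2)) * qfact (p + q + m).-1))).
  by rewrite -eq1; ring.
by rewrite (addnC p q) mulrCA -eq2; ring.
Qed.

(** * Sums of coefficients over a residue class *)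

Definition residue_sum n i P : K := \sum_(j < size P | j == i %[mod n]) P`_j.

Lemma residue_sumE n i P N : (size P <= N)%N ->
  residue_sum n i P = \sum_(j < N) P`_j * (j == i %[mod n])%:R.
Proof.
move=> leN; rewrite /residue_sum big_mkcond /=.
rewrite (big_ord_widen N (fun j => if j == i %[mod n] then P`_j else 0)) //.
rewrite big_mkcond; apply: eq_bigr => j _.
case: ltnP => [_|/leq_sizeP->]; rewrite ?mul0r //.
by case: eqP => _; rewrite ?mulr1 ?mulr0.
Qed.

Lemma residue_sumD n i P Q :
  residue_sum n i (P + Q) = residue_sum n i P + residue_sum n i Q.
Proof.
pose N := maxn (size P) (size Q).
rewrite !(@residue_sumE _ _ _ N) ?leq_maxl ?leq_maxr ?size_polyD //.
by rewrite -big_split; apply: eq_bigr => j _; rewrite coefD mulrDl.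
Qed.

Lemma residue_sumZ n i c P : residue_sum n i (c *: P) = c * residue_sum n i P.
Proof.
rewrite !(@residue_sumE _ _ _ (size P)) ?size_scale_leq // big_distrr /=.
by apply: eq_bigr => j _; rewrite coefZ mulrA.
Qed.

Lemma residue_sumXn n i k : residue_sum n i 'X^k = (k == i %[mod n])%:R.
Proof.
rewrite (@residue_sumE _ _ _ k.+1) ?size_polyXn // (bigD1 ord_max) //=.
rewrite coefXn eqxx mul1r big1 ?addr0 // => j nj.
by rewrite coefXn (_ : (j : nat) == k = false) ?mul0r //; apply/negbTE.
Qed.

Lemma residue_sum_sum n i (I : Type) (r : seq I) (G : I -> {poly K}) :
  residue_sum n i (\sum_(t <- r) G t) = \sum_(t <- r) residue_sum n i (G t).
Proof.
apply: (big_morph (residue_sum n i)) => [P Q|]; first exact: residue_sumD.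
by rewrite /residue_sum size_poly0 big_ord0.
Qed.

(** Each exponent [j] of [H] is spread over [g * k + j] for [k < c], which meets every class modulo
    [g * c] lying above the class of [j] modulo [g] exactly once. *)
Lemma residue_sum_dilate g c i H : (0 < g)%N -> (0 < c)%N ->
  residue_sum (g * c) i ((\sum_(k < c) 'X^(g * k)) * H) = residue_sum g i H.
Proof.
move=> g_gt0 c_gt0; rewrite -[in LHS](coefK H) poly_def big_distrr /= residue_sum_sum.
rewrite (@residue_sumE _ _ _ (size H)) //; apply: eq_bigr => -[j _] _ /=.
rewrite -scalerAr residue_sumZ; congr (_ * _).
rewrite big_distrl residue_sum_sum /=.
under eq_bigr do rewrite -exprD residue_sumXn.
have [eq_ji|ne_ji] := eqVneq (j %% g)%N (i %% g)%N; last first.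
  rewrite big1 // => k _; case: eqP => // e; case/eqP: ne_ji.
  have := congr1 (modn^~ g) e.
  by rewrite /= !modn_dvdm ?dvdn_mulr // mulnC modnMDl.
(* Replacing [i] by [g * c * j + i], in the same class, keeps the subtraction of [j] from
   truncating. *)
have le_j : (j <= g * c * j + i)%N.
  by rewrite (leq_trans _ (leq_addr _ _)) // leq_pmull ?muln_gt0 ?g_gt0.
have /dvdnP[t def_t] : (g %| g * c * j + i - j)%N.
  by rewrite -eqn_mod_dvd // -mulnA mulnC modnMDl eq_ji.
have def_i : (g * t + j = g * c * j + i)%N by rewrite mulnC -def_t subnK.
rewrite (bigD1 (Ordinal (ltn_pmod t c_gt0))) //=.
have keyP k : (g * k + j == i %[mod g * c])%N = (k == t %[mod c])%N.
  rewrite -(modnMDl j i) (mulnC j) -def_i eqn_modDr.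
  by rewrite -!muln_modr eqn_pmul2l.
rewrite keyP modn_mod eqxx big1 ?addr0 // => k nk.
rewrite keyP modn_small //; case: eqP => // e; case/eqP: nk.
exact/val_inj.
Qed.

Lemma residue_sumC n1 n2 i P1 P2 : (0 < n1)%N -> (0 < n2)%N ->
  qint n2 * P1 = qint n1 * P2 -> residue_sum n1 i P1 = residue_sum n2 i P2.
Proof.
move=> n1_gt0 n2_gt0 eqP12; case: (egcdnP n2 n1_gt0) => u v def_g _.
set g := gcdn n1 n2 in def_g; have g_gt0 : (0 < g)%N by rewrite gcdn_gt0 n1_gt0.
have [[c1 def_n1] [c2 def_n2]] := (dvdnP (dvdn_gcdl n1 n2), dvdnP (dvdn_gcdr n1 n2)).
rewrite -/g mulnC in def_n1; rewrite -/g mulnC in def_n2.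
(* From [u * n1 = v * n2 + g] comes a Bezout relation between q-integers. Multiplying it by [P1] and
   replacing [qint n2 * P1] by [qint n1 * P2] gives [qint g * P1 = qint n1 * H], and similarly for
   [P2]. *)
pose H := (\sum_(j < u) 'X^(n1 * j)) * P1 - 'X^g * (\sum_(j < v) 'X^(n2 * j)) * P2.
have bezout : qint g = qint n1 * (\sum_(j < u) 'X^(n1 * j)) -
    'X^g * (qint n2 * (\sum_(j < v) 'X^(n2 * j))).
  by rewrite -!qintM (mulnC n1) def_g addnC qintD (mulnC v) addrK.
have g_neq0 := qint_neq0 g_gt0.
set C1 := \sum_(j < u) _ in H bezout; set C2 := \sum_(j < v) _ in H bezout.
have def_P1 : P1 = (\sum_(k < c1) 'X^(g * k)) * H.
  apply: (mulfI g_neq0); rewrite [RHS]mulrA -qintM -def_n1 bezout /H.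
  transitivity (qint n1 * C1 * P1 - 'X^g * C2 * (qint n2 * P1)); first by ring.
  by rewrite eqP12; ring.
have def_P2 : P2 = (\sum_(k < c2) 'X^(g * k)) * H.
  apply: (mulfI g_neq0); rewrite [RHS]mulrA -qintM -def_n2 bezout /H.
  transitivity (C1 * (qint n1 * P2) - 'X^g * C2 * qint n2 * P2); first by ring.
  by rewrite -eqP12; ring.
rewrite def_P1 def_P2 def_n1 def_n2 !residue_sum_dilate //.
  by move: n2_gt0; rewrite def_n2 muln_gt0 => /andP[].
by move: n1_gt0; rewrite def_n1 muln_gt0 => /andP[].
Qed.
End QAnalogues.
(** * Traces on symmetric and exterior powers *)

Section SortedFunctions.

Variables (k d : nat).
Implicit Types (f q : {ffun 'I_k -> 'I_d}) (s : 'S_k).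

Definition word_of f : seq nat := [seq val (f j) | j <- enum 'I_k].

Definition canonical strict f := sorted (word_rel strict) (word_of f).

Lemma size_word_of f : size (word_of f) = k.
Proof. by rewrite size_map size_enum_ord. Qed.

Lemma word_of_inj : injective word_of.
Proof.
move=> f q /eq_in_map e; apply/ffunP => j; apply/val_inj/e.
by rewrite mem_enum.
Qed.

Lemma canonical_words strict :
  perm_eq [seq word_of f | f <- enum (canonical strict)] (words strict d k).
Proof.
apply: uniq_perm; rewrite ?words_uniq ?(map_inj_uniq word_of_inj) ?enum_uniq //.
move=> w; rewrite mem_words; apply/mapP/and3P => [[f]|].
  rewrite mem_enum => cf ->; rewrite size_word_of eqxx; split=> //.
  by apply/allP => _ /mapP[j _ ->]; apply: ltn_ord.
move=> [/eqP sz_w /allP w_lt w_sorted].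
have lt_w (j : 'I_k) : (nth 0 w j < d)%N by apply: w_lt; rewrite mem_nth ?sz_w.
have word_w : word_of [ffun j => Ordinal (lt_w j)] = w.
  transitivity (map (nth 0%N w) (map val (enum 'I_k))).
    by rewrite -map_comp; apply: eq_map => j; rewrite /= ffunE.
  by rewrite val_enum_ord -sz_w map_nth_iota0 ?take_size.
by exists [ffun j => Ordinal (lt_w j)]; rewrite // mem_enum unfold_in /canonical word_w.
Qed.

Lemma sum_canonical (K : fieldType) strict (x : K) :
  \sum_(f | canonical strict f) \prod_j x ^+ f j = (word_poly K strict d k).[x].
Proof.
rewrite /word_poly horner_sum -(perm_big _ (canonical_words strict)) big_map.
rewrite big_enum; apply: eq_bigr => f _.
by rewrite hornerXn sumnE big_map big_enum prodrXr.
Qed.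

Definition permf f s : {ffun 'I_k -> 'I_d} := [ffun j => f (s j)].

Lemma perm_word_of f q :
  reflect (exists s, f = permf q s) (perm_eq (word_of f) (word_of q)).
Proof.
have tupE g : word_of g = [tuple val (g j) | j < k] by [].
rewrite !tupE; apply: (iffP tuple_permP) => -[s].
  move=> e; exists s; apply/word_of_inj; rewrite tupE e; apply: eq_map => j /=.
  by rewrite tnth_mktuple ffunE.
move=> ->; exists s; apply: eq_map => j /=.
by rewrite tnth_mktuple ffunE.
Qed.

Lemma canonicalW f : canonical true f -> canonical false f.
Proof. by apply: sub_sorted => x y; apply: ltnW. Qed.

(** Together with [canonical_permf], this puts exactly one weakly sorted function in each orbit of
    ['S_k]. *)
Lemma canonical_perm_eq f q : canonical false f -> canonical false q ->
  perm_eq (word_of f) (word_of q) -> f = q.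
Proof.
move=> cf cq e; apply/word_of_inj/(sorted_eq _ _ cf cq e).
  exact: word_rel_trans.
by move=> x y; rewrite /word_rel /=; lia.
Qed.

Lemma canonical_permf f : exists s, canonical false (permf f s).
Proof.
have geq_total : total geq by move=> x y; rewrite /=; lia.
have tupE g : word_of g = [tuple val (g j) | j < k] by [].
have /tuple_permP[s e] : perm_eq (sort geq (word_of f)) [tuple val (f j) | j < k].
  by rewrite perm_sort.
exists s.
suff wE : word_of (permf f s) = sort geq (word_of f).
  by rewrite /canonical wE (eq_sorted (e' := geq)) ?sort_sorted.
by rewrite e; apply: eq_map => j /=; rewrite tnth_mktuple ffunE.
Qed.

Lemma canonical_strict f : canonical true f = injectiveb f && canonical false f.
Proof.
have -> : injectiveb f = uniq (word_of f).
  by rewrite /injectiveb /dinjectiveb -(map_inj_uniq val_inj) -map_comp.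
exact: gtn_sorted_uniq_geq.
Qed.

End SortedFunctions.

(** * Trace on a quotient of a tensor power *)

Section TensorQuotient.

Variables (F : fieldType) (gT : finGroupType) (G : {group gT}).

(* Phi is a family of linear forms on the quotient by U which is dual to the
   image of S; hence the rows of S map to an eigenbasis of the quotient. *)
Lemma mxtrace_factmod N r (rG : mx_representation F G N) (U : 'M_N)
    (Umod : mxmodule rG U) (S : 'M_(r, N)) (Phi : 'M_(N, r)) (D : 'rV_r) g :
  g \in G -> S *m Phi = 1%:M -> U *m Phi = 0 -> (1%:M <= S + U)%MS ->
  S *m rG g = diag_mx D *m S -> \tr (factmod_repr Umod g) = \sum_j D 0 j.
Proof.
move=> Gg SPhi UPhi spanSU eigS.
(* [B] holds the images of the rows of [S] in the quotient and [B'] the forms induced by [Phi].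
   Duality gives [B] a right inverse and spanning a left one, so [B] diagonalizes the action. *)
pose B := in_factmod U S; pose B' := val_factmod (1%:M : 'M_(\rank (cokermx U))) *m Phi.
have BB' : B *m B' = 1%:M.
  rewrite /B' mulmxA -val_factmodE -SPhi; apply/eqP; rewrite -subr_eq0 -mulmxBl.
  have : (val_factmod B - S <= U)%MS.
    by rewrite -in_factmod_eq0 linearB /= val_factmodK subrr.
  by case/submxP=> C ->; rewrite -mulmxA UPhi mulmx0.
have /row_fullP[C CB] : row_full B.
  rewrite -sub1mx -[X in (X <= _)%MS]val_factmodK.
  have := submxMr (col_base (cokermx U))
    (submx_trans (submx1 (val_factmod (1%:M : 'M_(\rank (cokermx U))))) spanSU).
  by rewrite addsmxC => /submx_trans; apply; rewrite (in_factmod_addsK U S).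
have BC : B *m C = 1%:M by rewrite -[C]mulmx1 -BB' (mulmxA C) CB mul1mx.
have eigB : B *m factmod_repr Umod g = diag_mx D *m B.
  by rewrite /= -in_factmodJ // eigS in_factmodE -mulmxA -in_factmodE.
rewrite -[factmod_repr Umod g]mul1mx -CB -mulmxA eigB mxtrace_mulC -mulmxA BC mulmx1.
exact: mxtrace_diag.
Qed.

Variables (k d : nat).
Local Notation T := {ffun 'I_k -> 'I_d}.
Implicit Types (f q : T) (P : 'M[F]_d).

Lemma eq_pure_tensor (v w : 'I_k -> 'rV[F]_d) : v =1 w -> pure_tensor v = pure_tensor w.
Proof.
by move=> e; apply/rowP=> x; rewrite !mxE; apply: eq_bigr => j _; rewrite e.
Qed.

Lemma tpow_mx_unit P : P \in unitmx -> tpow_mx k P \in unitmx.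
Proof.
move=> uP; have := mulmx1_unit (_ : tpow_mx k P *m tpow_mx k (invmx P) = 1%:M).
by rewrite -tpow_mxM mulmxV // tpow_mx1 => /(_ erefl)[].
Qed.

Lemma pure_tensor_mul (v : 'I_k -> 'rV[F]_d) r (Phi : 'M_(tpow_dim k d, r)) c :
  (pure_tensor v *m Phi) 0 c = \sum_(f : T) (\prod_j v j 0 (f j)) * Phi (enum_rank f) c.
Proof.
rewrite mxE [RHS](reindex (@tpow_index k d)) /=; last exact/onW_bij/enum_val_bij.
by apply: eq_bigr => x _; rewrite mxE enum_valK.
Qed.

Variables (rG : mx_representation F G d) (U : 'M[F]_(tpow_dim k d)).
Variables (Umod : mxmodule (tpow_repr k rG) U) (Q : pred T).

(* U will be the space of (anti)symmetry relations, and Q select one function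
   in each orbit of 'S_k; phi f q is the coordinate at q of the class of e_f. *)
Lemma mxtrace_tensor_quotient P (D : 'I_d -> F) (phi : T -> T -> F) g :
    g \in G -> P \in unitmx -> P *m rG g = diag_mx (\row_j D j) *m P ->
    {in Q &, forall f q, phi f q = (f == q)%:R} ->
    (forall q, q \in Q -> (U *m tpow_mx k (invmx P) *m
       (\col_x phi (enum_val x) q) = 0)) ->
    (forall f (W : 'M_(tpow_dim k d)), (U <= W)%MS ->
       (forall q, q \in Q -> (pure_tensor (fun j => row (q j) P) <= W)%MS) ->
       (pure_tensor (fun j => row (f j) P) <= W)%MS) ->
  \tr (factmod_repr Umod g) = \sum_(f : T | f \in Q) \prod_j D (f j).
Proof.
move=> Gg uP eigP phiQ phiU spanQ.
(* The rows of [S] are tensors of eigenvectors. The forms are composed with [tpow_mx k (invmx P)],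
   which passes to coordinates in the eigenbasis. *)
pose S := \matrix_(t < #|Q|) pure_tensor (fun j => row (enum_val t j) P).
pose Phi0 := \matrix_(x < tpow_dim k d, t < #|Q|) phi (enum_val x) (enum_val t).
pose weight : 'rV_#|Q| := \row_(t < #|Q|) \prod_j D ((enum_val t : T) j).
rewrite (@mxtrace_factmod _ _ (tpow_repr k rG) U Umod S
           (tpow_mx k (invmx P) *m Phi0) weight) //.
- rewrite [RHS]big_enum_val /=.
  by apply: eq_bigr => t _; rewrite mxE.
- apply/row_matrixP => t; rewrite mulmxA !row_mul rowK pure_tensor_mx.
  apply/rowP => u; rewrite pure_tensor_mul (bigD1 (enum_val t)) //= !mxE.
  rewrite big1 => [|j _]; last by rewrite -row_mul mulmxV // !mxE eqxx.
  rewrite mul1r enum_rankK phiQ ?enum_valP // (inj_eq enum_val_inj).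
  rewrite big1 ?addr0 // => f neq_f.
  have /existsP[j nj] : [exists j, f j != enum_val t j].
    rewrite -negb_forall; apply: contra neq_f => /forallP h.
    by apply/eqP/ffunP => j; apply/eqP.
  by rewrite (bigD1 j) //= -row_mul mulmxV // !mxE eq_sym (negPf nj) !mul0r.
- rewrite mulmxA; apply/matrixP => x t; rewrite [RHS]mxE.
  have /matrixP/(_ x 0) := phiU _ (enum_valP t); rewrite [RHS]mxE => <-.
  by rewrite !mxE; apply: eq_bigr => y _; rewrite !mxE.
- have : row_full (tpow_mx k P) by rewrite row_full_unit tpow_mx_unit.
  rewrite -sub1mx => /submx_trans; apply; apply/row_subP => x; rewrite rowK.
  apply: spanQ => [|q Qq]; first exact: addsmxSr.
  apply: submx_trans (addsmxSl _ _).
  rewrite (eq_row_sub (enum_rank_in Qq q)) // rowK.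
  by apply: eq_pure_tensor => j; rewrite enum_rankK_in.
apply/row_matrixP => t; rewrite row_mul rowK pure_tensor_mx mul_diag_mx.
apply/rowP => x; rewrite !mxE -big_split /=; apply: eq_bigr => j _.
by rewrite -row_mul eigP mul_diag_mx !mxE.
Qed.

End TensorQuotient.

(** * Symmetric and exterior powers as quotients *)

Section PowerTraces.

Variables (F : fieldType) (gT : finGroupType) (G : {group gT}).
Variables (k d : nat) (rG : mx_representation F G d).
Local Notation T := {ffun 'I_k -> 'I_d}.
Implicit Types (f q : T) (s : 'S_k) (v : 'I_k -> 'rV[F]_d).

Lemma pure_tensor_col v (phi : T -> T -> F) q :
  pure_tensor v *m (\col_x phi (enum_val x) q) =
  (\sum_(f : T) (\prod_j v j 0 (f j)) * phi f q)%:M.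
Proof.
apply/rowP => x; rewrite ord1 pure_tensor_mul !mxE eqxx mulr1n.
by apply: eq_bigr => f _; rewrite mxE enum_rankK.
Qed.

Lemma mxspan_mul0 N r (R : 'rV[F]_N -> Prop) (A : 'M_(N, r)) :
  (forall w, R w -> w *m A = 0) -> mxspan R *m A = 0.
Proof.
by move=> RA; apply/sub_kermxP; apply: (mxspanP R).2 => w /RA /sub_kermxP.
Qed.

Lemma mxtrace_sym P x g : g \in G -> P \in unitmx ->
  P *m rG g = diag_mx (\row_(j < d) x ^+ j) *m P ->
  \tr (sym_repr k rG g) = (word_poly F false d k).[x].
Proof.
move=> Gg uP eigP; rewrite -sum_canonical.
(* The coefficient of the monomial of [q] in that of [f]; it is invariant under permuting [f], hence
   kills the symmetry relations. *)
pose phi f q : F := (perm_eq (word_of f) (word_of q))%:R.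
apply: (mxtrace_tensor_quotient _ (phi := phi) Gg uP eigP) => [f q cf cq|q _|f W sUW WQ].
- by rewrite /phi; congr ((nat_of_bool _)%:R); apply/idP/eqP => [/canonical_perm_eq->|->].
- rewrite -mulmxA; apply: mxspan_mul0 => _ [v [s ->]].
  rewrite mulmxA mulmxBl !pure_tensor_mx mulmxBl !pure_tensor_col.
  apply/eqP; rewrite subr_eq0; apply/eqP; congr (_%:M); set w := fun j => _.
  rewrite [RHS](reindex (fun f => permf f s)) /=; last first.
    exists (fun f => permf f s^-1%g) => f _; apply/ffunP => j; rewrite !ffunE.
      by rewrite permKV.
    by rewrite permK.
  apply: eq_bigr => f _; congr (_ * _).
    by rewrite (reindex_perm s); apply: eq_bigr => j _; rewrite ffunE.
  have /permPl e : perm_eq (word_of (permf f s)) (word_of f).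
    by apply/perm_word_of; exists s.
  by rewrite /phi e.
have [s cs] := canonical_permf f.
(* The tensor of [f] is a symmetry relation plus the tensor of its sorted rearrangement. *)
rewrite -[pure_tensor _](subrK (pure_tensor (fun j => row (f (s j)) P))).
rewrite addmx_sub //; last first.
  by have := WQ _ cs; under eq_pure_tensor do rewrite ffunE.
apply: submx_trans sUW; apply: (mxspanP _).1.
by exists (fun j => row (f j) P), s.
Qed.

Lemma alt_relation_tperm v (a b : 'I_k) : a != b ->
  ((pure_tensor (fun j => v (tperm a b j)) + pure_tensor v)%R
     <= mxspan (@alt_relation F k d))%MS.
Proof.
move=> neq_ab; set U := mxspan _.
pose u x y j := if j == a then x else if j == b then y else v j.
have uE x y : pure_tensor (u x y) = \row_e
    (x 0 (tpow_index e a) * (y 0 (tpow_index e b) *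
     \prod_(j | (j != a) && (j != b)) v j 0 (tpow_index e j))).
  apply/rowP => e; rewrite !mxE (bigD1 a) //= (bigD1 b) 1?eq_sym //=.
  rewrite /u eqxx (eq_sym b) (negPf neq_ab) eqxx; congr (_ * (_ * _)).
  by apply: eq_bigr => j /andP[/negPf-> /negPf->].
have uU x : (pure_tensor (u x x) <= U)%MS.
  apply: (mxspanP _).1; exists (u x x); split=> //; exists a, b.
  by rewrite neq_ab /u !eqxx eq_sym (negPf neq_ab).
have -> : pure_tensor (fun j => v (tperm a b j)) = pure_tensor (u (v b) (v a)).
  apply: eq_pure_tensor => j; rewrite /u.
  case: tpermP => [->|->|/eqP/negPf-> /eqP/negPf->]; rewrite ?eqxx //.
  by rewrite eq_sym (negPf neq_ab).
have -> : pure_tensor v = pure_tensor (u (v a) (v b)).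
  apply: eq_pure_tensor => j; rewrite /u.
  by case: eqVneq => [->|_] //; case: eqVneq => [->|].
(* Polarization. *)
have -> : pure_tensor (u (v b) (v a)) + pure_tensor (u (v a) (v b)) =
    pure_tensor (u (v a + v b) (v a + v b)) - pure_tensor (u (v a) (v a)) -
    pure_tensor (u (v b) (v b)).
  by rewrite !uE; apply/rowP => e; rewrite !mxE; ring.
by rewrite !addmx_sub ?eqmx_opp ?uU.
Qed.

(** Modulo the relations each transposition only changes the sign, which does not affect membership
    in [W]; [s] is decomposed into transpositions. *)
Lemma alt_relation_perm v s (W : 'M[F]_(tpow_dim k d)) :
  (mxspan (@alt_relation F k d) <= W)%MS ->
  (pure_tensor (fun j => v (s j)) <= W)%MS -> (pure_tensor v <= W)%MS.
Proof.
move=> sUW; have [ts -> /= ts_d] := prod_tpermP s.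
elim: ts ts_d v => [_ v|[a b] ts IHts /= /andP[neq_ab ts_d] v].
  by rewrite big_nil; under eq_pure_tensor do rewrite perm1.
set r := (\prod_(t <- ts) tperm t.1 t.2)%g in IHts *.
rewrite big_cons => Wv; apply: (IHts ts_d).
have := submx_trans (alt_relation_tperm (fun j => v (r j)) neq_ab) sUW.
move: Wv; under eq_pure_tensor do rewrite permM /=.
move=> Wv Wsum; set w := (X in (X <= W)%MS).
rewrite -(addKr (pure_tensor (fun j => v (r (tperm a b j)))) w).
by rewrite addmx_sub ?eqmx_opp.
Qed.

Lemma mxtrace_ext P x g : g \in G -> P \in unitmx ->
  P *m rG g = diag_mx (\row_(j < d) x ^+ j) *m P ->
  \tr (ext_repr k rG g) = (word_poly F true d k).[x].
Proof.
move=> Gg uP eigP; rewrite -sum_canonical.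
(* The coordinate of the wedge of [f] at that of an injective [q]: the sign of the rearrangement if
   there is one, and 0 otherwise. *)
pose phi f q : F := \det (\matrix_(i, j) (f i == q j)%:R).
apply: (mxtrace_tensor_quotient _ (phi := phi) Gg uP eigP) => [f q cf cq|q _|f W sUW WQ].
- have inj_word (h : T) : canonical true h -> injective h.
    by rewrite canonical_strict => /andP[/injectiveP].
  have [<-|neq_fq] := eqVneq f q.
    rewrite /phi (_ : \matrix_(i, j) _ = 1%:M) ?det1 //.
    by apply/matrixP => i j; rewrite !mxE (inj_eq (inj_word _ cf)).
  (* Distinct strictly sorted functions have distinct value sets of equal size; a value missed by
     [q] gives a zero row. *)
  have [i fi] : exists i, f i \notin codom q.
    apply/existsP; apply: contraR neq_fq; rewrite negb_exists => /forallP sub_fq.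
    apply/eqP/canonical_perm_eq; rewrite ?canonicalW //.
    have uniq_word (h : T) : canonical true h -> uniq (word_of h).
      by rewrite -[canonical true h]/(sorted gtn _) gtn_sorted_uniq_geq => /andP[].
    have [uf uq] := (uniq_word _ cf, uniq_word _ cq).
    apply: uniq_perm => //.
    apply: (uniq_min_size uf _ _).2; rewrite ?size_word_of //.
    move=> _ /mapP[i _ ->]; have := sub_fq i; rewrite negbK => /codomP[j ->].
    by apply: map_f; rewrite mem_enum.
  rewrite /phi (expand_det_row _ i) big1 // => j _.
  rewrite mxE; case: eqP => [e|_]; last by rewrite mul0r.
  by case/negP: fi; rewrite e codom_f.
- rewrite -mulmxA; apply: mxspan_mul0 => _ [v [[a [b [neq_ab eq_v]]] ->]].
  rewrite mulmxA !pure_tensor_mx pure_tensor_col; pose w j := v j *m invmx P.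
  (* By multilinearity in the rows, the form at [q] sends a pure tensor to the minor on the columns
     chosen by [q], which has two equal rows on an alternating relation. *)
  rewrite (_ : \sum_f _ = \det (\matrix_(i, j) w i 0 (q j))).
    rewrite (determinant_alternate neq_ab) ?raddf0 // => j.
    by rewrite !mxE /w eq_v.
  rewrite /phi /determinant; under eq_bigr do rewrite big_distrr /=.
  rewrite exchange_big; apply: eq_bigr => s _ /=.
  under eq_bigr do rewrite mulrCA -big_split /=.
  rewrite -big_distrr /=; congr (_ * _).
  transitivity (\sum_(f : T) \prod_i (w i 0 (f i) * (f i == q (s i))%:R)).
    by apply: eq_bigr => f _; apply: eq_bigr => i _; rewrite !mxE.
  rewrite -(bigA_distr_bigA (fun i a => w i 0 a * (a == q (s i))%:R)).
  apply: eq_bigr => i _; rewrite (bigD1 (q (s i))) //= eqxx mulr1 mxE.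
  by rewrite big1 ?addr0 // => c /negPf nc; rewrite nc mulr0.
have [/injectiveP inj_f|] := boolP (injectiveb f).
  have [s cs] := canonical_permf f; apply: (alt_relation_perm (s := s) sUW).
  have cs' : canonical true (permf f s).
    rewrite canonical_strict cs andbT; apply/injectiveP => i j; rewrite !ffunE.
    by move/inj_f/perm_inj.
  by have := WQ _ cs'; under eq_pure_tensor do rewrite ffunE.
move/injectivePn => [a [b neq_ab eq_f]]; apply: submx_trans sUW.
apply: (mxspanP _).1; exists (fun j => row (f j) P); split=> //.
by exists a, b; rewrite eq_f.
Qed.

End PowerTraces.

(** * Isotypic components of cyclic groups *)

Section CyclicIsotypic.

Variables (F : fieldType) (gT : finGroupType) (a : gT) (z : F).
Hypothesis prim_z : #[a]%g.-primitive_root z.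
Local Notation n := #[a]%g.

(** The roots-of-unity filter: the mean over [k] of the powers of z^(j-i) is 1 when [j] and [i] are
    congruent modulo [n], and otherwise 0 by the geometric sum. *)
Lemma residue_sum_root i (P : {poly F}) :
  n%:R^-1 * (\sum_(k < n) z ^- (i * k) * P.[z ^+ k]) = residue_sum n i P.
Proof.
have n_neq0 := prim_root_natf_neq0 prim_z.
have z_neq0 : z != 0 by rewrite (prim_root_eq0 prim_z) -lt0n order_gt0.
rewrite -[in LHS](coefK P) poly_def (@residue_sumE _ _ _ _ (size P)) //.
under eq_bigr do rewrite horner_sum big_distrr /=.
rewrite exchange_big big_distrr /=; apply: eq_bigr => -[j _] _ /=.
under eq_bigr do rewrite hornerZ hornerXn mulrCA.
rewrite -big_distrr mulrCA /=; congr (_ * _).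
pose w := z ^+ j / z ^+ i.
rewrite (eq_bigr (fun k : 'I_n => w ^+ k)) => [|k _]; last first.
  by rewrite exprMn exprVn -!exprM (mulnC j) mulrC.
have w_n : w ^+ n = 1.
  rewrite exprMn exprVn -!exprM !(mulnC _ n) !exprM !(prim_expr_order prim_z).
  by rewrite !expr1n divr1.
rewrite -(eq_prim_root_expr prim_z); case: eqVneq => [eq_ij | neq_ij].
  rewrite /w eq_ij divff ?expf_neq0 //.
  by under eq_bigr do rewrite expr1n; rewrite sumr_const card_ord mulVf.
apply/eqP; rewrite mulf_eq0 invr_eq0 (negPf n_neq0) /=.
have := subrX1 w n; rewrite w_n subrr => /esym/eqP; rewrite mulf_eq0 subr_eq0.
case/orP => // /eqP w1; case/eqP: neq_ij.
by rewrite -[LHS](divfK (expf_neq0 i z_neq0)) -/w w1 mul1r.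
Qed.

(** In the rank factorization of [E], the factors multiplied in the opposite order give the identity
    of size [\rank E]. *)
Lemma mxrank_idempotent N (E : 'M[F]_N) : E *m E = E -> (\rank E)%:R = \tr E.
Proof.
move=> EE; have CR : row_base E *m col_base E = 1%:M.
  apply: (row_free_inj (row_base_free E)).
  apply: (row_full_inj (col_base_full E)).
  by rewrite mul1mx -mulmxA mulmx_base (mulmxA (col_base E)) mulmx_base.
by rewrite -[in RHS](mulmx_base E) mxtrace_mulC CR mxtrace1.
Qed.

(** The right-hand side is the trace of the averaging projector [E] onto the isotypic component. *)
Lemma rank_isotypic N (rG : mx_representation F <[a]> N) i :
  (\rank (isotypic_mx rG (cycle_char a z i)))%:R =
  n%:R^-1 * \sum_(k < n) z ^- (i * k) * \tr (rG (a ^+ k)%g).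
Proof.
have n_neq0 := prim_root_natf_neq0 prim_z.
have z_neq0 : z != 0 by rewrite (prim_root_eq0 prim_z) -lt0n order_gt0.
pose c k := z ^- (i * k) *: rG (a ^+ k)%g.
pose E := n%:R^-1 *: \sum_(k < n) c k.
set I := isotypic_mx _ _.
have IE : I *m E = I.
  rewrite -scalemxAr mulmx_sumr (eq_bigr (fun=> I)) => [|k _].
    by rewrite sumr_const card_ord -scaler_nat scalerA mulVf ?scale1r.
  rewrite -scalemxAr; apply/row_matrixP => r.
  rewrite linearZ /= row_mul (isotypic_mxP rG _ _ (row_sub r I)) ?mem_cycle //.
  by rewrite cycle_charX // scalerA mulVf ?scale1r ?expf_neq0.
have Ea k : E *m rG (a ^+ k)%g = z ^+ (i * k) *: E.
  elim: k => [|k IHk]; first by rewrite muln0 expr0 scale1r expg0 repr_mx1 mulmx1.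
  rewrite expgSr repr_mxM ?mem_cycle ?cycle_id // mulmxA IHk -scalemxAl.
  rewrite mulnSr exprD -scalerA; congr (_ *: _).
  rewrite -scalemxAl [RHS]scalerA mulrC -scalerA; congr (_ *: _).
  rewrite mulmx_suml scaler_sumr.
  have cS m : c m *m rG a = z ^+ i *: c m.+1.
    rewrite -scalemxAl /c scalerA -repr_mxM ?mem_cycle ?cycle_id // -expgSr.
    by rewrite mulnSr exprD invfM mulrCA divff ?mulr1 ?expf_neq0.
  under eq_bigr do rewrite cS.
  rewrite -!scaler_sumr; congr (_ *: _).
  (* The sum shifted by one closes up cyclically, since [c n = c 0]. *)
  rewrite -(big_mkord xpredT (fun m => c m.+1)) -(big_mkord xpredT c).
  rewrite -(prednK (order_gt0 a)) [LHS]big_nat_recr // [RHS]big_nat_recl //= addrC.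
  congr (_ + _); rewrite prednK ?order_gt0 // /c expg_order muln0 expr0 expg0.
  by rewrite mulnC exprM (prim_expr_order prim_z) expr1n.
have EI : (E <= I)%MS.
  apply/row_subP => r; apply/isotypic_mxP => _ /cycleP[k ->].
  by rewrite cycle_charX // -row_mul Ea linearZ.
have eqEI : (E :=: I)%MS by apply/eqmxP; rewrite EI -{1}IE submxMl.
have EE : E *m E = E.
  by case/submxP: EI => B defE; rewrite {1}defE -mulmxA IE -defE.
rewrite -eqEI (mxrank_idempotent EE) linearZ linear_sum /=; congr (_ * _).
by apply: eq_bigr => k _; rewrite linearZ.
Qed.

(** * Fourier eigenbasis of the regular representation *)

Lemma cycle_char_prod i : {in <[a]>%g &, forall g h,
  cycle_char a z i (g * h)%g = cycle_char a z i g * cycle_char a z i h}.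
Proof.
move=> _ _ /cycleP[k ->] /cycleP[l ->].
by rewrite -expgD !cycle_charX // mulnDr exprD.
Qed.

(** Row [j] lists the [j]-th power of the basic character at inverses. Right translation by [g]
    moves the value at [y * g^-1] to [y], so the inverse yields the eigenvalue of [g] rather than of
    [g^-1]. *)
Definition cycle_fourier : 'M[F]_(gcard <[a]>) :=
  Vandermonde _ (\row_x cycle_char a z 1 (enum_val x)^-1%g).

Lemma cycle_fourier_unit : cycle_fourier \in unitmx.
Proof.
rewrite unitmxE det_Vandermonde unitfE.
apply/prodf_neq0 => x _; apply/prodf_neq0 => y lt_xy.
rewrite !mxE subr_eq0; apply: contraTneq lt_xy => eq_xy.
suff -> : x = y by rewrite ltnn.
apply/enum_val_inj/invg_inj; move: eq_xy.
have /cycleP[k ->] := groupVr (enum_valP x).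
have /cycleP[l ->] := groupVr (enum_valP y).
rewrite !cycle_charX // !mul1n => /esym/eqP; rewrite (eq_prim_root_expr prim_z).
by rewrite -eq_expg_mod_order => /eqP.
Qed.

Lemma cycle_fourier_eig k :
  cycle_fourier *m regular_repr F <[a]> (a ^+ k)%g =
  diag_mx (\row_j (z ^+ k) ^+ j) *m cycle_fourier.
Proof.
have Ga := mem_cycle a k; rewrite mul_diag_mx; apply/matrixP => j y; rewrite !mxE.
have Gy := enum_valP y.
have Gx : (enum_val y * (a ^+ k)^-1)%g \in <[a]>%g by rewrite groupM ?groupV.
rewrite (bigD1 (gring_index <[a]> (enum_val y * (a ^+ k)^-1)%g)) //= !mxE.
rewrite gring_indexK // mulgKV gring_valK !eqxx mulr1 big1 ?addr0 => [|x nx].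
  rewrite invMg invgK cycle_char_prod ?groupV // exprMn; congr (_ ^+ _ * _).
  by rewrite cycle_charX // mul1n.
rewrite !mxE eqxx /= (_ : y == _ = false) ?mulr0 //.
apply: contraNF nx => /eqP ->.
by rewrite gring_indexK ?groupM ?enum_valP // mulgK gring_valK.
Qed.

Lemma rank_isotypic_powers p m i :
  (\rank (isotypic_mx (prod_repr (sym_repr p (regular_repr F <[a]>))
     (ext_repr m (regular_repr F <[a]>))) (cycle_char a z i)))%:R =
  residue_sum n i (pair_poly F n p m).
Proof.
rewrite rank_isotypic -residue_sum_root; congr (_ * _); apply: eq_bigr => k _.
congr (_ * _); rewrite /= mxtrace_prod hornerM.
have Ga := mem_cycle a k; have eigP := cycle_fourier_eig k.
rewrite -(mxtrace_sym p Ga cycle_fourier_unit eigP).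
by rewrite -(mxtrace_ext m Ga cycle_fourier_unit eigP).
Qed.

End CyclicIsotypic.

Theorem mainTheorem2 (R : realType) (p q m i : nat)
    (hqm : (1 <= q + m)%N) (hpm : (1 <= p + m)%N)
    (gT1 : finGroupType) (a1 : gT1) (z1 : R[i])
    (ha1 : #[a1]%g = (q + m)%N) (hz1 : (q + m)%N.-primitive_root z1)
    (gT2 : finGroupType) (a2 : gT2) (z2 : R[i])
    (ha2 : #[a2]%g = (p + m)%N) (hz2 : (p + m)%N.-primitive_root z2) :
  let R1 := regular_repr R[i] <[a1]>%G in
  let R2 := regular_repr R[i] <[a2]>%G in
  \rank (isotypic_mx (prod_repr (sym_repr p R1) (ext_repr m R1))
           (cycle_char a1 z1 i)) =
  \rank (isotypic_mx (prod_repr (sym_repr q R2) (ext_repr m R2))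
           (cycle_char a2 z2 i)).
Proof.
move=> R1 R2; rewrite -ha1 in hz1; rewrite -ha2 in hz2.
(* The rank formula lives in the field, so the ranks are compared in [R[i]], where naturals embed
   injectively. *)
apply/eqP; rewrite -(Num.Theory.eqr_nat R[i]) !rank_isotypic_powers //; apply/eqP.
rewrite ha1 ha2; apply: residue_sumC => //; exact: pair_polyC.
Qed.
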